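(* Let $Y_2\sim Bi(M,p)$ ($M\in\mathbb{N}$, $0<p<1$, $q=1-p$) and $Y_3\sim\mathrm{NB}(r,\bar p)$ ($r>0$, $0<\bar p<1$, $\bar q=1-\bar p$) be independent, so that $Y_{23}=Y_2+Y_3$ has probability generating function $(q+pz)^M\big(\frac{\bar p}{1-\bar qz}\big)^r$, and assume $p<q$. Then each of the following four operators, defined for $j\in\mathbb{Z}_+$ and $g\in\mathcal{G}_{Y_{23}}$, is a Stein operator for $Y_{23}$, i.e. $\mathbb{E}(\mathcal{A}_ig)(Y_{23})=0$ for all $g\in\mathcal{G}_{Y_{23}}$, $i=1,2,3,4$: $$(\mathcal{A}_1g)(j)=(Mp+rq\bar q-pj+q\bar qj)g(j+1)+(r\bar qp-Mp\bar q+p\bar qj)g(j+2)-qj\,g(j),$$ $$(\mathcal{A}_2g)(j)=p\Big(\frac{r\bar q}{p\bar p}+M-j\Big)g(j+1)-qj\,g(j)+r(q\bar q+p)\sum_{m=2}^\infty\bar q^{\,m-1}\sum_{l=1}^{m-1}\Delta g(j+l),$$ $$(\mathcal{A}_3g)(j)=\bar q\Big(\frac{Mp\bar p}{\bar q}+r+j\Big)g(j+1)-j\,g(j)+M\Big(\frac pq+\bar q\Big)\sum_{m=2}^\infty(-1)^{m+1}\Big(\frac pq\Big)^{m-1}\sum_{l=1}^{m-1}\Delta g(j+l),$$ $$(\mathcal{A}_4g)(j)=\Big(Mp+\frac{r\bar q}{\bar p}\Big)g(j+1)-j\,g(j)+\sum_{m=2}^\infty\Big(M(-1)^{m+1}\Big(\frac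 pq\Big)^m+r\bar q^{\,m}\Big)\sum_{l=1}^{m-1}\Delta g(j+l).$$
   Context: $\mathbb{Z}_+=\{0,1,2,\dots\}$. $\Delta g(j)=g(j+1)-g(j)$. For a $\mathbb{Z}_+$-valued random variable $Y$ with finite mean, $\mathcal{G}_Y$ is the set of bounded functions $g:\mathbb{Z}_+\to\mathbb{R}$ with $g(0)=0$ and $g(x)=0$ for $x\notin \mathrm{supp}(Y)$. A Stein operator for $Y$ is a linear operator $\mathcal{A}$ such that $\mathbb{E}(\mathcal{A}g)(Y)=0$ for all $g\in\mathcal{G}_Y$. $\mathrm{NB}(r,\bar p)$ is the negative binomial distribution with $P(Y_3=j)=\frac{\Gamma(r+j)}{\Gamma(r)j!}\bar p^r\bar q^j$, $j\in\mathbb{Z}_+$. *)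

(* Defs.v *)
From HB Require Import structures.
From mathcomp Require Export all_boot all_order all_algebra.
From mathcomp Require Export all_classical all_reals all_analysis.
Export Order.TTheory GRing.Theory Num.Theory.
Export numFieldNormedType.Exports.

Set Implicit Arguments.
Unset Strict Implicit.
Unset Printing Implicit Defensive.

Local Open Scope classical_set_scope.
Local Open Scope ring_scope.

Definition independent_RV d d1 d2 (T : measurableType d)
    (T1 : measurableType d1) (T2 : measurableType d2) (R : realType)
    (P : probability T R) (X1 : {RV P >-> T1}) (X2 : {RV P >-> T2}) : Prop :=
  forall (A : set T1) (B : set T2), measurable A -> measurable B ->
    (P (X1 @^-1` A `&` X2 @^-1` B) = P (X1 @^-1` A) * P (X2 @^-1` B))%E.

Definition Gamma (R : realType) (x : R) : R :=
  Rintegral (@lebesgue_measure R) `]0, +oo[ (fun t => t `^ (x - 1) * expR (- t)).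

Definition negative_binomial_pmf (R : realType) (r pbar : R) (j : nat) : R :=
  Gamma (r + j%:R) / (Gamma r * j`!%:R) * pbar `^ r * (1 - pbar) ^+ j.

Definition has_binomial_law d (T : measurableType d) (R : realType)
    (P : probability T R) (Y : {RV P >-> nat}) (M : nat) (p : R) : Prop :=
  forall A : set nat, distribution P Y A = binomial_prob M p A.

Definition has_negative_binomial_law d (T : measurableType d) (R : realType)
    (P : probability T R) (Y : {RV P >-> nat}) (r pbar : R) : Prop :=
  forall j : nat, P (Y @^-1` [set j]) = (negative_binomial_pmf r pbar j)%:E.

Definition supp_RV d (T : measurableType d) (R : realType)
    (P : probability T R) (Y : {RV P >-> nat}) : set nat :=
  [set k | (0 < P (Y @^-1` [set k]))%E].

Definition stein_class d (T : measurableType d) (R : realType)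
    (P : probability T R) (Y : {RV P >-> nat}) : set (nat -> R) :=
  [set g | [/\ exists B : R, forall x, `|g x| <= B,
               g 0%N = 0 &
               forall x, ~ supp_RV Y x -> g x = 0]].

Definition linear_on (R : realType) (G : set (nat -> R))
    (A : (nat -> R) -> nat -> R) : Prop :=
  forall (a b : R) (g h : nat -> R), G g -> G h ->
    A (fun x => a * g x + b * h x) = (fun j => a * A g j + b * A h j).

(* 'E_P is the extended-real integral, where +oo - +oo = -oo; so its being 0
   entails that A g (Y) is integrable. *)
Definition stein_operator d (T : measurableType d) (R : realType)
    (P : probability T R) (Y : {RV P >-> nat})
    (A : (nat -> R) -> nat -> R) : Prop :=
  linear_on (stein_class Y) A /\
  forall g, stein_class Y g -> ('E_P[fun w => A g (Y w)] = 0)%E.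

Definition fwd_diff (R : realType) (g : nat -> R) (j : nat) : R :=
  g j.+1 - g j.

Definition weighted_diff_term (R : realType) (c : nat -> R) (g : nat -> R)
    (j m : nat) : R :=
  c m * \sum_(1 <= l < m) fwd_diff g (j + l)%N.

Definition weighted_diff_sum (R : realType) (c : nat -> R) (g : nat -> R)
    (j : nat) : nat -> R :=
  fun n => \sum_(2 <= m < n) weighted_diff_term c g j m.

Definition weighted_diff_converges (R : realType) (c : nat -> R)
    (g : nat -> R) (j : nat) : Prop :=
  cvgn (weighted_diff_sum c g j).

(* The limit is a junk value when weighted_diff_converges fails. *)
Definition weighted_diff_series (R : realType) (c : nat -> R) (g : nat -> R)
    (j : nat) : R :=
  limn (weighted_diff_sum c g j).

Definition weight2 (R : realType) (pbar : R) (m : nat) : R :=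
  (1 - pbar) ^+ m.-1.

Definition weight3 (R : realType) (p : R) (m : nat) : R :=
  (-1) ^+ m.+1 * (p / (1 - p)) ^+ m.-1.

Definition weight4 (R : realType) (M : nat) (p r pbar : R) (m : nat) : R :=
  M%:R * (-1) ^+ m.+1 * (p / (1 - p)) ^+ m + r * (1 - pbar) ^+ m.

Definition A1 (R : realType) (M : nat) (p r pbar : R)
    (g : nat -> R) (j : nat) : R :=
  let q := 1 - p in let qbar := 1 - pbar in
  (M%:R * p + r * q * qbar - p * j%:R + q * qbar * j%:R) * g j.+1
  + (r * qbar * p - M%:R * p * qbar + p * qbar * j%:R) * g j.+2
  - q * j%:R * g j.

Definition A2 (R : realType) (M : nat) (p r pbar : R)
    (g : nat -> R) (j : nat) : R :=
  let q := 1 - p in let qbar := 1 - pbar in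
  p * (r * qbar / (p * pbar) + M%:R - j%:R) * g j.+1 - q * j%:R * g j
  + r * (q * qbar + p) * weighted_diff_series (weight2 pbar) g j.

Definition A3 (R : realType) (M : nat) (p r pbar : R)
    (g : nat -> R) (j : nat) : R :=
  let q := 1 - p in let qbar := 1 - pbar in
  qbar * (M%:R * p * pbar / qbar + r + j%:R) * g j.+1 - j%:R * g j
  + M%:R * (p / q + qbar) * weighted_diff_series (weight3 p) g j.

Definition A4 (R : realType) (M : nat) (p r pbar : R)
    (g : nat -> R) (j : nat) : R :=
  let q := 1 - p in let qbar := 1 - pbar in
  (M%:R * p + r * qbar / pbar) * g j.+1 - j%:R * g j
  + weighted_diff_series (weight4 M p r pbar) g j.

(* Main.v *)
Require Import Defs.
From mathcomp Require Import measurable_realfun ring lra zify.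

(* For bounded f, put Y = Y2 + Y3 and
     D2 f = q Y2 f(Y) + p Y2 f(Y + 1) - M p f(Y + 1),
     D3 f = Y3 f(Y) - qbar Y3 f(Y + 1) - r qbar f(Y + 1).
   Conditioning on the other summand, the first-order recurrences of the two
   probability mass functions give E (D2 f) = E (D3 f) = 0.  With the geometric
   sums L_a g(j) = sum_(m >= 0) a^m g(j + m), which solve
   L_a g(j) = g(j) + a L_a g(j + 1), and with f' = f(. + 1),
     A1 g(Y) = - D2 g + qbar D2 g' - q D3 g - p D3 g',
     A2 g(Y) = - D2 g - q D3 (L_qbar g) - p D3 (L_qbar g)',
     A3 g(Y) = - D3 g - D2 (L_(-p/q) g) / q + (qbar / q) D2 (L_(-p/q) g)',
     A4 g(Y) = - D2 (L_(-p/q) g) / q - D3 (L_qbar g),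
   so no exchange of expectation and series is needed. *)

Set Implicit Arguments.
Unset Strict Implicit.
Unset Printing Implicit Defensive.

Local Open Scope classical_set_scope.
Local Open Scope ring_scope.

(** * The functional equation of the Gamma function *)

Section Gamma.
Context {R : realType}.
Implicit Types (a b s t : R).
Let mu := @lebesgue_measure R.

Lemma cvgn_powR_expRN s : (fun n : nat => n%:R `^ s * expR (- n%:R)) @ \oo --> (0 : R).
Proof.
wlog s0 : s / 0 < s.
  (* For [n >= 1] the power grows with its exponent, so the positive exponent [|s| + 1]
     dominates. *)
  move=> H; have s1 : 0 < `|s| + 1 by rewrite ltr_wpDl.
  apply: (@squeeze_cvgr _ _ _ _ (cst 0) (fun n => n%:R `^ (`|s| + 1) * expR (- n%:R))).
  - near=> n; rewrite mulr_ge0 ?powR_ge0 ?expR_ge0//= ler_pM2r ?expR_gt0//.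
    rewrite ler_powR//; last by have := ler_norm s; lra.
    by rewrite ler1n; near: n; exists 1%N.
  - exact: cvg_cst.
  - exact: H.
(* The bound [ln x <= x - 1] at [x = n / (2 s)] gives [s ln n <= n / 2 + C], so the sequence is at
   most [expR C] times a geometric one of ratio [expR (- 1/2)]. *)
pose C := s * ln (2 * s) - s.
apply: (@squeeze_cvgr _ _ _ _ (cst 0) (fun n => expR C * expR (- 2^-1) ^+ n)).
- near=> n; rewrite mulr_ge0 ?powR_ge0 ?expR_ge0//=.
  have n0 : 0 < n%:R :> R by rewrite ltr0n; near: n; exists 1%N.
  rewrite /powR gt_eqF// -expRM_natr -!expRD ler_expR.
  have n2s : 0 < n%:R / (2 * s) by rewrite divr_gt0// mulr_gt0.
  have : ln (n%:R / (2 * s)) <= n%:R / (2 * s) - 1.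
    by have := @le_ln1Dx R (n%:R / (2 * s) - 1); rewrite [1 + _]addrC subrK; apply; lra.
  rewrite ln_div ?posrE ?mulr_gt0// => h.
  have : s * (ln n%:R - ln (2 * s)) <= s * (n%:R / (2 * s) - 1) by rewrite ler_pM2l.
  have -> : s * (n%:R / (2 * s) - 1) = n%:R / 2 - s by field; rewrite gt_eqF.
  by rewrite /C; lra.
- exact: cvg_cst.
- rewrite -[X in _ --> X](mulr0 (expR C)); apply: cvgMl_tmp.
  apply: cvg_expr; rewrite ger0_norm ?expR_ge0// expR_lt1; lra.
Unshelve. all: by end_near. Qed.

Lemma within_continuous_powR s a b : 0 < a ->
  {within `[a, b], continuous (fun t : R => t `^ s)}.
Proof.
move=> a0; apply: continuous_in_subspaceT => t; rewrite inE/= in_itv/= => /andP[at' _].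
apply: differentiable_continuous; apply/derivable1_diffP.
by apply: ex_derive; apply: is_derive1_powR; exact: lt_le_trans at'.
Qed.

Lemma derivable_powR_itv s a b : 0 < a -> a < b ->
  derivable_oo_LRcontinuous (fun t : R => t `^ s) a b.
Proof.
move=> a0 ab.
have [_ ca cb] := (continuous_within_itvP _ ab).1 (@within_continuous_powR s a b a0).
split => // t; rewrite in_itv/= => /andP[at' _].
by apply: ex_derive; apply: is_derive1_powR; exact: lt_trans at'.
Qed.

(** Integration by parts with antiderivative [- expR (- t)]. The interval stays away from 0, where
    [t ^ s] may fail to be differentiable. *)
Lemma Gamma_integral_parts s a b : 0 < a -> a < b ->
  (\int[mu]_(t in `[a, b]) (t `^ s * expR (- t))%:E =
   (a `^ s * expR (- a) - b `^ s * expR (- b))%:E +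
   s%:E * \int[mu]_(t in `[a, b]) (t `^ (s - 1) * expR (- t))%:E)%E.
Proof.
move=> a0 ab.
have dG (t : R) : is_derive t 1 (fun t : R => - expR (- t)) (expR (- t)).
  by apply: is_derive_eq; rewrite mulrN1 opprK.
have cE : continuous (fun t : R => expR (- t)).
  by move=> t; apply/differentiable_continuous/derivable1_diffP.
have cg : {within `[a, b], continuous (fun t : R => expR (- t))}.
  by apply: continuous_subspaceT.
have cG : {within `[a, b], continuous (fun t : R => - expR (- t))}.
  apply: continuous_subspaceT => t.
  by apply/differentiable_continuous/derivable1_diffP; exact: ex_derive.
have cf : {within `[a, b], continuous (fun t : R => s * t `^ (s - 1))}.
  apply/subspace_continuousP => t abt; apply: cvgM; first exact: cvg_cst.
  by move/subspace_continuousP: (@within_continuous_powR (s - 1) a b a0); exact.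
have [_ ca cb] := (continuous_within_itvP _ ab).1 cG.
rewrite (@integration_by_parts R (fun t => t `^ s) (fun t => - expR (- t))
  (fun t => s * t `^ (s - 1)) (fun t => expR (- t)))//.
- rewrite (_ : (fun x => (s * x `^ (s - 1) * - expR (- x))%:E) =
      (fun x => (- s)%:E * (x `^ (s - 1) * expR (- x))%:E)%E); last first.
    by apply/funext => t; rewrite -EFinM; congr (_%:E); ring.
  rewrite integralZl//=; last first.
    apply: continuous_compact_integrable; first exact: segment_compact.
    apply/subspace_continuousP => t abt; apply: cvgM.
      by move/subspace_continuousP: (@within_continuous_powR (s - 1) a b a0); exact.
    by move/subspace_continuousP: cg; exact.
  by rewrite EFinN mulNe oppeK; congr (_%:E + _)%E; ring.
- exact: derivable_powR_itv.
- by move=> t; rewrite in_itv/= => /andP[at' _];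
    rewrite derive1E; apply: derive_val; apply: is_derive1_powR; exact: lt_trans at'.
- by split => // t _; exact: ex_derive.
- by move=> t _; rewrite derive1E; apply: derive_val.
Qed.

(** An exhaustion of the half-line for monotone convergence. Starting at 2 keeps every interval
    nondegenerate, as integration by parts requires. *)
Lemma bigcup_itv_inv_nat :
  \bigcup_n `[(n.+2%:R : R)^-1, n.+2%:R]%classic = `]0, +oo[%classic.
Proof.
apply/seteqP; split => t /=.
  move=> [n _] /=; rewrite !in_itv/= andbT => /andP[+ _].
  by apply: lt_le_trans; rewrite invr_gt0.
rewrite in_itv/= andbT => t0.
(* Each positive [x] is at most [trunc x + 1]; the sum of the two truncations serves [t] and its
   inverse at once. *)
exists (Num.trunc t + Num.trunc t^-1)%N => //=; rewrite in_itv/=.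
have ht (x : R) : 0 < x -> x <= (Num.trunc x).+1%:R.
  by move=> x0; rewrite ltW// -truncn_lt_nat// ltW.
apply/andP; split.
  rewrite -[leRHS]invrK lef_pV2 ?posrE ?invr_gt0//.
  apply: (le_trans (ht t^-1 _)); first by rewrite invr_gt0.
  by rewrite ler_nat; lia.
by apply: (le_trans (ht t _)) => //; rewrite ler_nat; lia.
Qed.

Lemma measurable_powR_expRN s (D : set R) : measurable D ->
  measurable_fun D (EFin \o (fun t : R => t `^ s * expR (- t))).
Proof.
move=> mD; apply/measurable_EFinP/measurable_funM.
  by apply: measurable_funTS; exact: measurable_powR.
by apply: measurable_funTS; apply: measurableT_comp.
Qed.

Lemma cvgn_Gamma_integral s :
  (\int[mu]_(t in `[(n.+2%:R^-1)%R, n.+2%:R%R]) (t `^ s * expR (- t))%:E)%E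
    @[n --> \oo] --> (\int[mu]_(t in `]0%R, +oo[) (t `^ s * expR (- t))%:E)%E.
Proof.
rewrite -bigcup_itv_inv_nat; apply: ge0_nondecreasing_set_cvg_integral.
- apply/nondecreasing_seqP => n; rewrite subsetEset.
  apply: subset_itv; rewrite bnd_simp ?lef_pV2 ?posrE ?ler_nat//.
- by [].
- by move=> n; exact: measurable_powR_expRN.
- by move=> n t _; rewrite lee_fin mulr_ge0 ?powR_ge0 ?expR_ge0.
Qed.

Lemma Gamma_integralS s : 0 < s ->
  (\int[mu]_(t in `]0%R, +oo[) (t `^ s * expR (- t))%:E =
   s%:E * \int[mu]_(t in `]0%R, +oo[) (t `^ (s - 1) * expR (- t))%:E)%E.
Proof.
move=> s0; apply: (cvg_unique _ (@cvgn_Gamma_integral s)) => //.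
(* The boundary terms. Near 0 they vanish because [s > 0], at infinity by exponential decay. *)
pose e (n : nat) : R := (n.+2%:R : R)^-1 `^ s * expR (- (n.+2%:R : R)^-1) -
  n.+2%:R `^ s * expR (- n.+2%:R).
have e0 : e n @[n --> \oo] --> (0 : R).
  rewrite /e -[X in _ --> X](subr0 0); apply: cvgB; last first.
    under eq_fun do rewrite -addn2.
    by have := @cvgn_powR_expRN s; rewrite -(cvg_shiftn 2).
  apply: (@squeeze_cvgr _ _ _ _ (cst 0) (fun n => (n.+2%:R : R)^-1 `^ s)).
  - near=> n; rewrite mulr_ge0 ?powR_ge0 ?expR_ge0//=.
    by rewrite ler_piMr ?powR_ge0// expR_le1 oppr_le0.
  - exact: cvg_cst.
  - apply: ((cvg_at_rightP _ _ _).1 (powR_cvg0 s0)); split=> [n|].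
      by rewrite invr_gt0.
    by have := @cvg_harmonic R; rewrite -(cvg_shiftn 1); under eq_fun do rewrite addn1.
rewrite (_ : (fun n => _) = (fun n => (e n)%:E +
    s%:E * \int[mu]_(t in `[(n.+2%:R^-1)%R, n.+2%:R%R])
             (t `^ (s - 1) * expR (- t))%:E)%E); last first.
  apply/funext => n; rewrite Gamma_integral_parts// ?invr_gt0//.
  by rewrite (@lt_trans _ _ 1)// ?invf_lt1 ?ltr1n.
rewrite -[(s%:E * integral mu `]0%R, +oo[%classic _)%E]add0e; apply: cvgeD.
- by [].
- by apply: cvg_EFin => //; exact: nearW.
- by apply: cvgeZl => //; exact: cvgn_Gamma_integral.
Unshelve. all: by end_near. Qed.

(* The integral need not be shown finite: were it [+oo], both sides would be 0. *)
Lemma GammaS s : 0 < s -> Gamma (s + 1) = s * Gamma s.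
Proof.
move=> s0; rewrite /Gamma /Rintegral addrK Gamma_integralS//.
move: (integral _ _ _) => [x| |]/=; first by [].
  by rewrite gt0_muley ?lte_fin//= mulr0.
by rewrite gt0_muleNy ?lte_fin//= mulr0.
Qed.

End Gamma.

(** * Expectations of functions of natural-valued random variables *)

Section ProbNat.
Context d (T : measurableType d) (R : realType) (P : probability T R).
Implicit Types (X Y Z : {RV P >-> nat}) (g h : nat -> R).

Lemma measurable_fun_nat_RV Y h : measurable_fun setT (fun w => h (Y w)).
Proof. by apply: (measurableT_comp (f := h)). Qed.
Hint Resolve measurable_fun_nat_RV : core.

Lemma ge0_integral_nat_RV (D : set T) Z h : measurable D -> (forall i, 0 <= h i) ->
  (\int[P]_(w in D) (h (Z w))%:E =
   \sum_(0 <= i <oo) (h i)%:E * P (D `&` Z @^-1` [set i]))%E.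
Proof.
move=> mD h0.
have mZ i : measurable (Z @^-1` [set i]).
  by rewrite -[X in measurable X]setTI; exact: measurable_funP.
rewrite {1}(_ : D = \bigcup_i (D `&` Z @^-1` [set i])); last first.
  apply/seteqP; split=> [w Dw|w [i _ []]//].
  by exists (Z w).
rewrite ge0_integral_bigcup//.
- apply: eq_eseriesr => i _.
  rewrite -(@integral_cst _ _ _ P); last exact: measurableI.
  by apply: eq_integral => w /set_mem [_ /= ->].
- by move=> k; exact: measurableI.
- by apply/measurable_EFinP/measurable_funTS.
- by move=> w _; rewrite lee_fin.
- apply/trivIsetP => i j _ _ ij; rewrite -subset0 => w [[_ /= Zi] [_ /= Zj]].
  by move/eqP: ij; rewrite -Zi -Zj.
Qed.

Lemma independent_RV_sym X Z : independent_RV X Z -> independent_RV Z X.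
Proof. by move=> h A B mA mB; rewrite setIC h// muleC. Qed.

Lemma ge0_integral_indep X Z k h : independent_RV X Z -> (forall i, 0 <= h i) ->
  (\int[P]_(w in X @^-1` [set k]) (h (Z w))%:E =
   P (X @^-1` [set k]) * \int[P]_w (h (Z w))%:E)%E.
Proof.
move=> hind h0.
have mX : measurable (X @^-1` [set k]).
  by rewrite -[X in measurable X]setTI; exact: measurable_funP.
rewrite !ge0_integral_nat_RV// -(fineK (fin_num_measure P _ mX)) -nneseriesZl; last first.
  by move=> i _; rewrite mule_ge0 ?lee_fin.
apply: eq_eseriesr => i _; rewrite setTI fineK ?fin_num_measure// hind//.
by rewrite muleCA.
Qed.

(** The space is partitioned by the value of [X]: on [X = k] one has [Y = k + Z], and independence
    factors out the probability of that event. Nonnegativity allows infinite values. *)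
Lemma ge0_integral_indepM X Z Y f g :
  independent_RV X Z -> (forall w, Y w = (X w + Z w)%N) ->
  (forall i, 0 <= f i) -> (forall i, 0 <= g i) ->
  (\int[P]_w (f (X w) * g (Y w))%:E =
   \sum_(0 <= k <oo) (f k)%:E * (P (X @^-1` [set k]) * \int[P]_w (g (k + Z w)%N)%:E))%E.
Proof.
move=> hind hY f0 g0.
have mX k : measurable (X @^-1` [set k]).
  by rewrite -[X in measurable X]setTI; exact: measurable_funP.
have TE : setT = \bigcup_k (X @^-1` [set k]).
  by apply/seteqP; split=> // w _; exists (X w).
have mfg : measurable_fun setT (fun w => (f (X w) * g (Y w))%:E).
  by apply/measurable_EFinP/measurable_funM.
rewrite {1}TE ge0_integral_bigcup//.
- apply: eq_eseriesr => k _.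
  have /= <- := @ge0_integral_indep X Z k (fun i => g (k + i)%N) hind (fun i => g0 _).
  rewrite -ge0_integralZl//.
  + by apply: eq_integral => w /set_mem /= Xk; rewrite EFinM hY Xk.
  + apply/measurable_EFinP/measurable_funTS.
    exact: (measurable_fun_nat_RV Z (fun i => g (k + i)%N)).
  + by move=> w _; rewrite lee_fin.
  + by rewrite lee_fin.
- by rewrite -TE.
- by move=> w _; rewrite lee_fin mulr_ge0.
- apply/trivIsetP => i j _ _ ij; rewrite -subset0 => w [/= Xi Xj].
  by move/eqP: ij; rewrite -Xi -Xj.
Qed.

(** * From a recurrence for the mass function of one summand to an identity in expectation *)

Section stein_recurrence.
Variables (X Y Z : {RV P >-> nat}) (b : nat -> R) (al be ga de : R).
Hypothesis hind : independent_RV X Z.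
Hypothesis hY : forall w, Y w = (X w + Z w)%N.
Hypothesis hb : forall k, P (X @^-1` [set k]) = (b k)%:E.
Hypotheses (be0 : 0 <= be) (ga0 : 0 <= ga) (de0 : 0 <= de).
Hypothesis dea : de < al.
(* Four nonnegative coefficients, so that the recurrence can be summed in [\bar R]
   before the mean of [X] is known to be finite. *)
Hypothesis hrec : forall k,
  al * k.+1%:R * b k.+1 + be * k%:R * b k = ga * b k + de * k%:R * b k.

Let al0 : 0 <= al. Proof. exact: ltW (le_lt_trans de0 dea). Qed.

Let b0 k : 0 <= b k. Proof. by rewrite -lee_fin -hb. Qed.

(** With [S k] the expectation of [g (k + Z)], conditioning on [X] turns each integral into a
    series. After an index shift in the first one, all four carry the factor [S k.+1], and [hrec]
    matches them term by term. *)
Lemma ge0_stein_recurrence g : (forall i, 0 <= g i) ->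
  (al%:E * \int[P]_w ((X w)%:R * g (Y w))%:E +
   be%:E * \int[P]_w ((X w)%:R * g (Y w).+1)%:E =
   ga%:E * \int[P]_w (g (Y w).+1)%:E +
   de%:E * \int[P]_w ((X w)%:R * g (Y w).+1)%:E)%E.
Proof.
move=> g0.
pose S k := (\int[P]_w (g (k + Z w)%N)%:E)%E.
have S0 k : (0 <= S k)%E by apply: integral_ge0 => w _; rewrite lee_fin.
have E0 f : (forall i, 0 <= f i) -> (\int[P]_w (f (X w) * g (Y w))%:E =
    \sum_(0 <= k <oo) (f k)%:E * ((b k)%:E * S k))%E.
  move=> f0; rewrite (ge0_integral_indepM hind hY)//.
  by apply: eq_eseriesr => k _; rewrite hb.
have E1 f : (forall i, 0 <= f i) -> (\int[P]_w (f (X w) * g (Y w).+1)%:E =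
    \sum_(0 <= k <oo) (f k)%:E * ((b k)%:E * S k.+1))%E.
  move=> f0; rewrite (ge0_integral_indepM (g := fun i => g i.+1) hind hY)//.
  by apply: eq_eseriesr => k _; rewrite hb.
have -> : (\int[P]_w (g (Y w).+1)%:E =
    \sum_(0 <= k <oo) (1%R)%:E * ((b k)%:E * S k.+1))%E.
  by rewrite -E1//; apply: eq_integral => w _; rewrite mul1r.
have n0 (k : nat) : 0 <= k%:R :> R by [].
rewrite (E0 (fun k => k%:R) n0) (E1 (fun k => k%:R) n0).
have t0 (c c' : R) k : 0 <= c -> 0 <= c' -> (0 <= c%:E * (c'%:E * S k))%E.
  by move=> c0 c'0; rewrite !mule_ge0 ?lee_fin.
(* The term [k = 0] vanishes through its factor [k], so the first series may start at 1 and be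
   shifted. *)
rewrite nneseries_recl//; last by move=> k _; exact: t0.
rewrite mul0e add0e -(nneseries_addn 1); last by move=> k; exact: t0.
rewrite -!nneseriesZl; try by move=> k _; exact: t0.
rewrite -!nneseriesD; try by move=> k _ _; rewrite mule_ge0 ?lee_fin// t0.
apply: eq_eseriesr => k _; rewrite addn1.
rewrite !muleA -!EFinM -!ge0_muleDl ?lee_fin ?mulr_ge0//.
by rewrite -!EFinD hrec mulr1.
Qed.

(** Summing [hrec] over [k < n] bounds [al * a n.+1] by [ga + de * a n.+1] for the partial sums [a]
    of the mean. Since [de < al], the mean is at most [ga / (al - de)]. *)
Lemma integral_nat_RV_lty : (\int[P]_w ((X w)%:R)%:E < +oo)%E.
Proof.
pose a n := \sum_(0 <= k < n) k%:R * b k.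
have sb n : \sum_(0 <= k < n) b k <= 1.
  rewrite -lee_fin -[leRHS](@probability_setT _ _ _ P).
  rewrite -[leRHS]mul1e -integral_cst//.
  rewrite (ge0_integral_nat_RV X (h := fun=> 1))//.
  under eq_eseriesr => i _ do rewrite mul1e setTI hb.
  rewrite -sumEFin; apply: (nneseries_lim_ge n) => k _ _.
  by rewrite lee_fin.
have ha n : a n.+1 <= ga / (al - de).
  rewrite ler_pdivlMr ?subr_gt0// mulrBr.
  have an : a n <= a n.+1.
    by rewrite [leRHS]big_nat_recr//= lerDl mulr_ge0.
  have : al * a n.+1 + be * a n = ga * (\sum_(0 <= k < n) b k) + de * a n.
    rewrite /a big_nat_recl//= mul0r add0r !mulr_sumr -!big_split/=.
    by apply: eq_bigr => k _; have := hrec k; rewrite !mulrA.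
  have : 0 <= be * a n by rewrite mulr_ge0// sumr_ge0// => k _; rewrite mulr_ge0.
  have : ga * (\sum_(0 <= k < n) b k) <= ga by rewrite ler_piMr.
  have : de * a n <= de * a n.+1 by rewrite ler_wpM2l.
  by lra.
rewrite (ge0_integral_nat_RV X (h := fun k => k%:R))//.
apply: (@le_lt_trans _ _ (ga / (al - de))%:E); last exact: ltry.
apply: lime_le.
  by apply: is_cvg_nneseries => k _ _; rewrite mule_ge0 ?lee_fin.
near=> n.
under eq_bigr => i _ do rewrite setTI hb -EFinM.
rewrite sumEFin lee_fin.
rewrite -[n]prednK; last by near: n; exists 1%N.
exact: ha.
Unshelve. all: by end_near. Qed.

End stein_recurrence.

Definition bounded_seq g := exists B : R, forall x, `|g x| <= B.

Lemma bounded_seqD g h (a b : R) : bounded_seq g -> bounded_seq h ->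
  bounded_seq (fun x => a * g x + b * h x).
Proof.
move=> [B hB] [C hC]; exists (`|a| * B + `|b| * C) => x.
by rewrite (le_trans (ler_normD _ _))// !normrM lerD// ler_wpM2l.
Qed.

(** Integrability is included so that linear combinations remain centered. *)
Definition centered (F : T -> R) :=
  P.-integrable setT (EFin \o F) /\ (\int[P]_w (F w)%:E = 0)%E.

Lemma centeredD F G (a b : R) : centered F -> centered G ->
  centered (fun w => a * F w + b * G w).
Proof.
move=> [iF F0] [iG G0].
have iaF : P.-integrable setT (fun w => (a%:E * (F w)%:E)%E) by apply: integrableZl.
have ibG : P.-integrable setT (fun w => (b%:E * (G w)%:E)%E) by apply: integrableZl.
split.
  by apply: eq_integrable (integrableD _ iaF ibG).
transitivity (\int[P]_w (a%:E * (F w)%:E + b%:E * (G w)%:E))%E.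
  by apply: eq_integral => w _; rewrite -!EFinM -EFinD.
by rewrite integralD// !integralZl// F0 G0 !mule0 adde0.
Qed.

(** * Extension of the identity to bounded functions of either sign *)

Section stein_bounded.
Variables (X Y Z : {RV P >-> nat}) (b : nat -> R) (al be ga de : R).
Hypothesis hind : independent_RV X Z.
Hypothesis hY : forall w, Y w = (X w + Z w)%N.
Hypothesis hb : forall k, P (X @^-1` [set k]) = (b k)%:E.
Hypotheses (be0 : 0 <= be) (ga0 : 0 <= ga) (de0 : 0 <= de).
Hypothesis dea : de < al.
Hypothesis hrec : forall k,
  al * k.+1%:R * b k.+1 + be * k%:R * b k = ga * b k + de * k%:R * b k.

Let integrable_XgY g : bounded_seq g ->
  P.-integrable setT (fun w => ((X w)%:R * g (Y w))%:E).
Proof.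
move=> [B hB].
have B0 : 0 <= B by apply: le_trans (hB 0%N).
have iX : P.-integrable setT (fun w => ((X w)%:R)%:E).
  apply/integrableP; split.
    by apply/measurable_EFinP; exact: (measurable_fun_nat_RV X (fun k => k%:R)).
  under eq_integral do rewrite /= ger0_norm//.
  exact: (integral_nat_RV_lty hb be0 ga0 de0 dea hrec).
apply: le_integrable (integrableZl _ B iX) => //.
  by apply/measurable_EFinP/measurable_funM.
move=> w _ /=; rewrite lee_fin !normrM mulrC ler_wpM2r//.
by rewrite (le_trans (hB _))// ler_norm.
Qed.

Let integrable_gY g : bounded_seq g -> P.-integrable setT (fun w => (g (Y w))%:E).
Proof.
move=> [B hB]; apply: measurable_bounded_integrable => //.
  by apply: (le_lt_trans (probability_le1 P measurableT)); exact: ltry.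
by exists B; split; [exact: num_real|move=> N BN w _ /=; rewrite (le_trans (hB _))// ltW].
Qed.

Let F g w := al * (X w)%:R * g (Y w) +
  (be - de) * (X w)%:R * g (Y w).+1 - ga * g (Y w).+1.

Let centered_ge0 g : bounded_seq g -> (forall i, 0 <= g i) -> centered (F g).
Proof.
move=> bg g0.
have bg1 : bounded_seq (fun i => g i.+1) by have [B hB] := bg; exists B.
have i1 := integrable_XgY bg.
have i2 := integrable_XgY bg1.
have i3 := integrable_gY bg1.
have FE w : ((F g w)%:E = (al%:E * ((X w)%:R * g (Y w))%:E +
   (be - de)%:E * ((X w)%:R * g (Y w).+1)%:E) + (- ga)%:E * (g (Y w).+1)%:E)%E.
  by rewrite -!EFinM -!EFinD /F; congr EFin; ring.
have j1 := integrableZl measurableT al i1.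
have j2 := integrableZl measurableT (be - de) i2.
have j3 := integrableZl measurableT (- ga) i3.
have j12 := integrableD measurableT j1 j2.
split.
  by apply: eq_integrable (integrableD _ j12 j3) => // w _ /=; rewrite FE.
under eq_integral do rewrite FE.
rewrite integralD// integralD// !integralZl//.
have := ge0_stein_recurrence hind hY hb be0 ga0 de0 dea hrec g0.
move: (integrable_fin_num measurableT i1) (integrable_fin_num measurableT i2)
  (integrable_fin_num measurableT i3).
(* All three integrals are finite, so the extended-real identity becomes one between reals, where
   the two shifted terms merge into the coefficient [be - de]. *)
move=> /fineK <- /fineK <- /fineK <-.
rewrite -!EFinM -!EFinD => -[h]; congr EFin; lra.
Qed.

(** [F] is linear in [g], and [g = (g + B) - B] is a difference of two nonnegative bounded
    functions. *)
Lemma centered_stein_recurrence g : bounded_seq g -> centered (F g).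
Proof.
move=> bg; have [B hB] := bg.
have B0 : 0 <= B by apply: le_trans (hB 0%N).
have bc : bounded_seq (fun=> B) by exists B => x; rewrite ger0_norm.
have := centeredD 1 (-1) (centered_ge0 (g := fun x => 1 * g x + 1 * B) _ _)
  (centered_ge0 (g := fun=> B) bc (fun=> B0)).
rewrite (_ : (fun w => _) = F g); last by apply/funext => w; rewrite /F; ring.
apply; first exact: bounded_seqD.
by move=> i; have := hB i; rewrite ler_norml => /andP[]; lra.
Qed.

End stein_bounded.
End ProbNat.

(** * Geometric sums and the weighted difference series *)

Section GeomSum.
Context {R : realType}.
Implicit Types (a b : R) (c g h : nat -> R) (j m n : nat).

(** For [|a| < 1] and bounded [g] this is the resolvent [(1 - a E)^-1 g] of the shift
    [E g = g(. + 1)]. *)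
Definition geom_sum a g j : R := limn (series (fun m => a ^+ m * g (j + m)%N)).

Lemma norm_geom_series a g B j n : `|a| < 1 -> (forall x, `|g x| <= B) ->
  [normed series (fun m => a ^+ m * g (j + m)%N)] n <= B / (1 - `|a|).
Proof.
move=> a1 hB; have B0 : 0 <= B by apply: le_trans (hB 0%N).
apply: (@le_trans _ _ (series (geometric B `|a|) n)).
  apply: ler_sum => m _; rewrite /= normrM normrX mulrC.
  by rewrite /geometric/= ler_wpM2r// exprn_ge0.
(* The comparison with the geometric limit is applied with a positive ratio; at [a = 0] only the
   term [m = 0] survives. *)
have [->|a0] := eqVneq a 0.
  rewrite normr0 subr0 divr1 /series/=; case: n => [|n]; first by rewrite big_nil.
  rewrite big_nat_recl//= expr0 mulr1 big1 ?addr0// => i _.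
  by rewrite expr0n/= mulr0.
by apply: geometric_le_lim; rewrite ?normr_gt0 ?normr_id.
Qed.

Lemma cvg_geom_sum a g j : `|a| < 1 -> bounded_seq g ->
  series (fun m => a ^+ m * g (j + m)%N) @ \oo --> geom_sum a g j.
Proof.
move=> a1 [B hB]; apply: (@normed_cvg _ R^o).
apply: nondecreasing_is_cvgn.
  apply/nondecreasing_seqP => n; rewrite /series/= [leRHS]big_nat_recr//=.
  by rewrite lerDl.
by exists (B / (1 - `|a|)) => _ [n _ <-]; exact: norm_geom_series.
Qed.

Lemma bounded_geom_sum a g : `|a| < 1 -> bounded_seq g -> bounded_seq (geom_sum a g).
Proof.
move=> a1 bg; have [B hB] := bg; exists (B / (1 - `|a|)) => j.
have cg := cvg_geom_sum (j := j) a1 bg.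
rewrite -(cvg_lim (@Rhausdorff R) (cvg_norm cg)).
apply: limr_le; first by apply/cvg_ex; eexists; exact: cvg_norm cg.
near=> n; apply: (le_trans _ (norm_geom_series j n a1 hB)).
exact: ler_norm_sum.
Unshelve. all: by end_near. Qed.

Lemma geom_sumS a g j : `|a| < 1 -> bounded_seq g ->
  geom_sum a g j = g j + a * geom_sum a g j.+1.
Proof.
move=> a1 bg.
have c1 := cvg_geom_sum (j := j) a1 bg.
have c2 := cvg_geom_sum (j := j.+1) a1 bg.
suff c : series (fun m => a ^+ m * g (j + m)%N) @ \oo -->
    g j + a * geom_sum a g j.+1 by exact: (cvg_unique (@Rhausdorff R) c1 c).
rewrite -cvg_shiftS.
rewrite (_ : (fun n => _) =
    (fun n => g j + a * series (fun m => a ^+ m * g (j.+1 + m)%N) n)).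
  by apply: cvgD; [exact: cvg_cst|apply: cvgM => //; exact: cvg_cst].
apply/funext => n; rewrite /series/= big_nat_recl//= expr0 mul1r addn0 mulr_sumr.
by congr (_ + _); apply: eq_bigr => m _; rewrite addSnnS exprS mulrA.
Qed.

(** The series starts at [m = 2], so weights may be rewritten by formulas that fail at [m = 0],
    where [m.-1] is truncated. *)
Lemma eq_weighted_diff_sum c c' g j : (forall m, (1 < m)%N -> c m = c' m) ->
  weighted_diff_sum c g j = weighted_diff_sum c' g j.
Proof.
move=> cc'; apply/funext => n; apply: eq_big_nat => m /andP[m1 _].
by rewrite /weighted_diff_term cc'.
Qed.

Lemma weighted_diff_sumDl a b c c' g j n :
  weighted_diff_sum (fun m => a * c m + b * c' m) g j n =
  a * weighted_diff_sum c g j n + b * weighted_diff_sum c' g j n.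
Proof.
rewrite /weighted_diff_sum !mulr_sumr -big_split/=; apply: eq_bigr => m _.
by rewrite /weighted_diff_term mulrDl !mulrA.
Qed.

Lemma weighted_diff_sumDr a b c g h j n :
  weighted_diff_sum c (fun x => a * g x + b * h x) j n =
  a * weighted_diff_sum c g j n + b * weighted_diff_sum c h j n.
Proof.
rewrite /weighted_diff_sum !mulr_sumr -big_split/=; apply: eq_bigr => m _.
rewrite /weighted_diff_term /fwd_diff !mulr_sumr -big_split/=.
by apply: eq_bigr => l _; ring.
Qed.

Lemma weighted_diff_seriesD a b c g h j :
  weighted_diff_converges c g j -> weighted_diff_converges c h j ->
  weighted_diff_series c (fun x => a * g x + b * h x) j =
  a * weighted_diff_series c g j + b * weighted_diff_series c h j.
Proof.
move=> cg ch; apply: (cvg_lim (@Rhausdorff R)).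
rewrite (_ : weighted_diff_sum _ _ _ = (fun n =>
  a * weighted_diff_sum c g j n + b * weighted_diff_sum c h j n)); last first.
  by apply/funext => n; rewrite weighted_diff_sumDr.
by apply: cvgD; apply: cvgM => //; exact: cvg_cst.
Qed.

(** The inner sum telescopes to [g (j + m) - g (j + 1)]. This vanishes at [m = 1], so the series may
    start there, and it splits into a geometric sum at [j + 1] and a plain geometric series. *)
Lemma cvg_weighted_diff_geom a g j : `|a| < 1 -> bounded_seq g ->
  weighted_diff_sum (fun m => a ^+ m.-1) g j @ \oo -->
    geom_sum a g j.+1 - g j.+1 / (1 - a).
Proof.
move=> a1 bg; rewrite -cvg_shiftS.
rewrite (_ : (fun n => _) = (fun n => series (fun m => a ^+ m * g (j.+1 + m)%N) n -
    series (geometric (g j.+1) a) n)).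
  by apply: cvgB; [exact: cvg_geom_sum|exact: cvg_geometric_series].
apply/funext => n; rewrite /weighted_diff_sum /weighted_diff_term /series/=.
rewrite -sumrB; case: n => [|n]; first by rewrite !big_geq.
rewrite [RHS]big_ltn// expr0 addn0 mul1r mulr1 subrr add0r big_add1/=.
apply: eq_big_nat => m /andP[m0 _].
rewrite (@telescope_sumr_eq _ 1 m.+1 (fun l => g (j + l)%N)); first last.
- by move=> l _; rewrite /fwd_diff addnS.
- by rewrite ltnS ltnW.
- by rewrite /geometric/= addn1 addnS addSn; ring.
Qed.

End GeomSum.

(** * First-order recurrences of the two probability mass functions *)

Lemma binomial_pmfS (R : realType) (M k : nat) (p : R) :
  (1 - p) * k.+1%:R * binomial_pmf M p k.+1 + p * k%:R * binomial_pmf M p k =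
  M%:R * p * binomial_pmf M p k.
Proof.
rewrite /binomial_pmf /unstable.onem.
have [kM|Mk] := ltnP k M.
  rewrite -[in LHS]mulr_natr -[in X in _ + X]mulr_natr -[in RHS]mulr_natr.
  (* The recurrence comes from [(k + 1) C(M, k + 1) = (M - k) C(M, k)]. *)
  have := congr1 (fun n : nat => n%:R : R) (mul_bin_left M k).
  rewrite /= !natrM natrB ?(ltnW kM)// => h.
  rewrite (_ : (M - k)%N = (M - k.+1).+1); last by lia.
  rewrite !exprS.
  transitivity ((1 - p) * p * p ^+ k * (1 - p) ^+ (M - k.+1) * (k.+1%:R * 'C(M, k.+1)%:R)
    + p * k%:R * (p ^+ k * ((1 - p) * (1 - p) ^+ (M - k.+1)) * 'C(M, k)%:R)); first by ring.
  by rewrite h; ring.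
(* For [k >= M] the mass at [k + 1] is zero. At [k = M] the two remaining terms coincide; beyond [M]
   they vanish. *)
rewrite bin_small// mulr0n mulr0 add0r.
have [->|Mk'] := eqVneq k M; first by ring.
by rewrite bin_small ?mulr0n ?mulr0// ltn_neqAle eq_sym Mk'.
Qed.

(** The factor [r + k] comes from the functional equation of Gamma at [r + k], the factor [k + 1]
    from the factorial. *)
Lemma negative_binomial_pmfS (R : realType) (r pbar : R) (k : nat) : 0 < r ->
  k.+1%:R * negative_binomial_pmf r pbar k.+1 =
  (1 - pbar) * (r + k%:R) * negative_binomial_pmf r pbar k.
Proof.
move=> r0; rewrite /negative_binomial_pmf.
have -> : r + k.+1%:R = r + k%:R + 1 by rewrite -natr1 addrA.
rewrite GammaS; last by rewrite ltr_wpDr.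
rewrite factS natrM !invfM exprS.
have k1 : k.+1%:R != 0 :> R by rewrite pnatr_eq0.
rewrite (_ : k.+1%:R * _ = (k.+1%:R / k.+1%:R) * ((1 - pbar) * (r + k%:R) *
  (Gamma (r + k%:R) * ((Gamma r)^-1 * k`!%:R^-1) * pbar `^ r * (1 - pbar) ^+ k))).
  by rewrite mulfV// mul1r.
by ring.
Qed.

(** * The four Stein operators *)

Theorem proposition2p4 (R : realType) (d : measure_display)
    (T : measurableType d) (P : probability T R)
    (M : nat) (p r pbar : R)
    (Y2 Y3 Y23 : {RV P >-> nat})
    (hM : (0 < M)%N) (hp : 0 < p < 1) (hr : 0 < r) (hpbar : 0 < pbar < 1)
    (hY2 : has_binomial_law Y2 M p)
    (hY3 : has_negative_binomial_law Y3 r pbar)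
    (hind : independent_RV Y2 Y3)
    (hY23 : forall w, Y23 w = (Y2 w + Y3 w)%N)
    (hpq : p < 1 - p) :
  (forall g, stein_class Y23 g -> forall j : nat,
     [/\ weighted_diff_converges (weight2 pbar) g j,
         weighted_diff_converges (weight3 p) g j &
         weighted_diff_converges (weight4 M p r pbar) g j]) /\
  [/\ stein_operator Y23 (A1 M p r pbar),
      stein_operator Y23 (A2 M p r pbar),
      stein_operator Y23 (A3 M p r pbar) &
      stein_operator Y23 (A4 M p r pbar)].
Proof.
have /andP[p0 p1] := hp; have /andP[pb0 pb1] := hpbar.
pose q := 1 - p; pose qb := 1 - pbar.
have q0 : 0 < q by rewrite /q; lra.
have qb0 : 0 < qb by rewrite /qb; lra.
have q_neq0 : q != 0 by rewrite gt_eqF.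
have aqb : `|qb| < 1 by rewrite ger0_norm ?(ltW qb0)// /qb; lra.
(* The assumption [p < q] enters here: it makes the alternating geometric sums converge. *)
have apq : `|- (p / q)| < 1.
  by rewrite normrN ger0_norm ?divr_ge0 ?ltW// ltr_pdivrMr// mul1r.
pose L2 := geom_sum (- (p / q)); pose L3 := geom_sum qb.
have bst g : stein_class Y23 g -> bounded_seq g by case.
have bS (g : nat -> R) : bounded_seq g -> bounded_seq (fun i => g i.+1).
  by move=> [B hB]; exists B.
have c2 (g : nat -> R) j : bounded_seq g ->
    weighted_diff_sum (weight2 pbar) g j @ \oo --> L3 g j.+1 - g j.+1 / pbar.
  move=> bg; have := cvg_weighted_diff_geom (j := j) aqb bg.
  by rewrite (_ : 1 - qb = pbar)//; rewrite /qb; ring.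
have w3E m : (1 < m)%N -> weight3 p m = (- (p / q)) ^+ m.-1.
  case: m => [//|m _]; rewrite /weight3/= [in RHS]exprNn; congr (_ * _).
  by rewrite !exprS mulrA mulrNN mulr1 mul1r.
have one_q : 1 - - (p / q) = q^-1 by rewrite opprK /q; field.
have c3 g j : bounded_seq g ->
    weighted_diff_sum (weight3 p) g j @ \oo --> L2 g j.+1 - g j.+1 * q.
  move=> bg; rewrite (eq_weighted_diff_sum _ _ w3E).
  by have := cvg_weighted_diff_geom (j := j) apq bg; rewrite one_q invrK.
(* The weights of [A4] combine those of [A3] and [A2], one power of [p / q] and of [qb] being moved
   into the constants. *)
have w4E m : (1 < m)%N -> weight4 M p r pbar m =
    M%:R * (p / q) * (- (p / q)) ^+ m.-1 + r * qb * qb ^+ m.-1.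
  move=> m1; rewrite -(w3E _ m1); case: m m1 => [//|m _].
  rewrite /weight4 /weight3/= -/q -/qb [(p / q) ^+ m.+1]exprS [qb ^+ m.+1]exprS.
  by ring.
have c4 g j : bounded_seq g ->
    weighted_diff_sum (weight4 M p r pbar) g j @ \oo -->
      M%:R * (p / q) * (L2 g j.+1 - g j.+1 * q) +
      r * qb * (L3 g j.+1 - g j.+1 / pbar).
  move=> bg; rewrite (eq_weighted_diff_sum _ _ w4E).
  rewrite (_ : weighted_diff_sum _ _ _ = (fun n =>
     M%:R * (p / q) * weighted_diff_sum (weight3 p) g j n +
     r * qb * weighted_diff_sum (weight2 pbar) g j n)).
    by apply: cvgD; apply: cvgM; [exact: cvg_cst|exact: c3|exact: cvg_cst|exact: c2].
  by apply/funext => n; rewrite weighted_diff_sumDl -(eq_weighted_diff_sum _ _ w3E).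
have cv g : bounded_seq g -> forall j : nat,
     [/\ weighted_diff_converges (weight2 pbar) g j,
         weighted_diff_converges (weight3 p) g j &
         weighted_diff_converges (weight4 M p r pbar) g j].
  move=> bg j; split; apply/cvg_ex; eexists; [exact: c2|exact: c3|exact: c4].
split; first by move=> g /bst bg; exact: cv.
have s2 g j : bounded_seq g ->
    weighted_diff_series (weight2 pbar) g j = L3 g j.+1 - g j.+1 / pbar.
  by move=> bg; apply: (cvg_lim (@Rhausdorff R)); exact: c2.
have s3 g j : bounded_seq g ->
    weighted_diff_series (weight3 p) g j = L2 g j.+1 - g j.+1 * q.
  by move=> bg; apply: (cvg_lim (@Rhausdorff R)); exact: c3.
have s4 g j : bounded_seq g ->
    weighted_diff_series (weight4 M p r pbar) g j =
      M%:R * (p / q) * (L2 g j.+1 - g j.+1 * q) +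
      r * qb * (L3 g j.+1 - g j.+1 / pbar).
  by move=> bg; apply: (cvg_lim (@Rhausdorff R)); exact: c4.
have P2 k : P (Y2 @^-1` [set k]) = (binomial_pmf M p k)%:E.
  have := hY2 [set k]; rewrite /distribution/= /pushforward => ->.
  rewrite /binomial_prob !ltW// esum_set1// lee_fin.
  by apply: binomial_pmf_ge0; rewrite !ltW.
pose D2 g w := q * (Y2 w)%:R * g (Y23 w) + p * (Y2 w)%:R * g (Y23 w).+1
  - M%:R * p * g (Y23 w).+1.
pose D3 g w := (Y3 w)%:R * g (Y23 w) - qb * (Y3 w)%:R * g (Y23 w).+1
  - r * qb * g (Y23 w).+1.
(* The recurrence for [X = Y2] has [al = q], [be = p], [ga = M p], [de = 0]. *)
have D2c g : bounded_seq g -> centered P (D2 g).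
  move=> bg; have := @centered_stein_recurrence _ _ _ P Y2 Y23 Y3
    (binomial_pmf M p) q p (M%:R * p) 0 hind hY23 P2 (ltW p0) _ _ q0 _ g bg.
  rewrite subr0; apply => //; first by rewrite mulr_ge0// ltW.
  by move=> k; rewrite binomial_pmfS !mul0r addr0.
(* The summands exchange roles: [X = Y3] with [al = 1], [be = 0], [ga = r qb], [de = qb], and
   [de < al] reads [qb < 1]. *)
have D3c g : bounded_seq g -> centered P (D3 g).
  move=> bg; have := @centered_stein_recurrence _ _ _ P Y3 Y23 Y2
    (negative_binomial_pmf r pbar) 1 0 (r * qb) qb (independent_RV_sym hind) _ hY3
    _ _ _ _ _ g bg.
  rewrite (_ : (fun w => _) = D3 g); last first.
    by apply/funext => w; rewrite /D3; ring.
  apply=> //; rewrite ?mulr_ge0 ?ltW//.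
  - by move=> w; rewrite hY23 addnC.
  - by rewrite /qb; lra.
  - by move=> k; rewrite mul1r negative_binomial_pmfS// -/qb; ring.
have hL2 g j : bounded_seq g -> L2 g j = g j + - (p / q) * L2 g j.+1.
  exact: geom_sumS.
have hL3 g j : bounded_seq g -> L3 g j = g j + qb * L3 g j.+1.
  exact: geom_sumS.
have natY w : (Y23 w)%:R = (Y2 w)%:R + (Y3 w)%:R :> R by rewrite hY23 natrD.
have E0 F G : centered P F -> F = G -> ('E_P[G] = 0)%E.
  by move=> [_ F0] <-; rewrite unlock.
split; split.
- by move=> a b g h _ _; apply/funext => j; rewrite /A1; ring.
- move=> g /bst bg; apply: E0 (centeredD 1 1
    (centeredD (-1) qb (D2c _ bg) (D2c _ (bS _ bg)))
    (centeredD (- q) (- p) (D3c _ bg) (D3c _ (bS _ bg)))) _.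
  by apply/funext => w; rewrite /A1 /D2 /D3 natY /q /qb; ring.
(* Linearity of the limit needs both series to converge, which boundedness in the Stein class
   provides. *)
- move=> a b g h sg sh; apply/funext => j; rewrite /A2.
  have [[cg _ _] [ch _ _]] := (cv _ (bst _ sg) j, cv _ (bst _ sh) j).
  by rewrite weighted_diff_seriesD//; ring.
- move=> g /bst bg.
  have bL : bounded_seq (L3 g) by exact: bounded_geom_sum.
  apply: E0 (centeredD (-1) 1 (D2c _ bg)
    (centeredD (- q) (- p) (D3c _ bL) (D3c _ (bS _ bL)))) _.
  apply/funext => w; rewrite /A2 s2// /D2 /D3 natY.
  (* Unfolding twice leaves [g (Y)], [g (Y + 1)] and [L3 g (Y + 2)] as independent unknowns, and the
     claim becomes a rational identity. *)
  rewrite (hL3 g (Y23 w))// (hL3 g (Y23 w).+1)//.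
  rewrite /q /qb; field.
  by rewrite !gt_eqF.
- move=> a b g h sg sh; apply/funext => j; rewrite /A3.
  have [[_ cg _] [_ ch _]] := (cv _ (bst _ sg) j, cv _ (bst _ sh) j).
  by rewrite weighted_diff_seriesD//; ring.
- move=> g /bst bg.
  have bL : bounded_seq (L2 g) by exact: bounded_geom_sum.
  apply: E0 (centeredD (-1) 1 (D3c _ bg)
    (centeredD (- q^-1) (qb / q) (D2c _ bL) (D2c _ (bS _ bL)))) _.
  apply/funext => w; rewrite /A3 s3// /D2 /D3 natY.
  rewrite (hL2 g (Y23 w))// (hL2 g (Y23 w).+1)//.
  move: q_neq0; rewrite /q /qb => q_neq0; field.
  by rewrite q_neq0 gt_eqF.
- move=> a b g h sg sh; apply/funext => j; rewrite /A4.
  have [[_ _ cg] [_ _ ch]] := (cv _ (bst _ sg) j, cv _ (bst _ sh) j).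
  by rewrite weighted_diff_seriesD//; ring.
- move=> g /bst bg.
  have bL2 : bounded_seq (L2 g) by exact: bounded_geom_sum.
  have bL3 : bounded_seq (L3 g) by exact: bounded_geom_sum.
  apply: E0 (centeredD (- q^-1) (-1) (D2c _ bL2) (D3c _ bL3)) _.
  apply/funext => w; rewrite /A4 s4// /D2 /D3 natY.
  (* One unfolding suffices here, since only the values of [L2 g] and [L3 g] at [Y] and [Y + 1]
     occur. *)
  rewrite (hL2 g (Y23 w))// (hL3 g (Y23 w))//.
  move: q_neq0; rewrite /q /qb => q_neq0; field.
  by rewrite q_neq0 gt_eqF.
Qed.
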